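(* Let $G$ be a connected graph on $n$ vertices with resistance deviations $\delta_1,\dots,\delta_n$ and resistance deviation operator $T$. Let $n_+$ denote the number of positive deviations (number of indices $i$ with $\delta_i>0$) and $n_-$ the number of negative deviations (number of indices $i$ with $\delta_i<0$). When $0$ does not occur as a resistance deviation, put $f(0)=\sum_{i=1}^n\frac1{\delta_i}$; there are then the following three possibilities for the inertia of $T$: (1) If $f(0)<0$, then $\operatorname{In}(T)=(n_+,\,n_--1,\,1)$. (2) If $f(0)>0$, then $\operatorname{In}(T)=(n_+-1,\,n_-,\,1)$. (3) If $f(0)=0$, then $\operatorname{In}(T)=(n_+-1,\,n_--1,\,2)$. If $0$ occurs as a resistance deviation with multiplicity $n_0$ (so exactly $n_0\ge1$ indices $i$ have $\delta_i=0$), then $\operatorname{In}(T)=(n_+,n_-,n_0)$.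
   Context: $G=(V,E)$ is a finite, simple, connected, undirected, unweighted graph with vertex set $V=\{1,\dots,n\}$. $L=D_G-A$ is its combinatorial Laplacian (degree matrix minus adjacency matrix). $\mathbf 1\in\mathbb R^n$ is the all-ones vector, $I$ the identity matrix, $J=\mathbf 1\mathbf 1^\top$, $P=I-\frac1n J$. $L^\dagger$ is the Moore--Penrose inverse of $L$, i.e. the unique symmetric matrix with $LL^\dagger=L^\dagger L=I-\frac1n\mathbf 1\mathbf 1^\top$ and $L^\dagger\mathbf 1=\mathbf 0$. Put $d_i=(L^\dagger)_{ii}$, $D=\operatorname{diag}(d_1,\dots,d_n)$, $\bar d=\frac1n\operatorname{tr}(L^\dagger)$, and $\Delta=D-\bar d I$, whose diagonal entries $\delta_1,\dots,\delta_n$ are the resistance deviations. The resistance deviation operator is the (symmetric) matrix $T=\Delta P+P\Delta-\Delta$. The function $f$ is $f(\lambda)=\sum_{j=1}^n\frac{1}{\delta_j-\lambda}$. The inertia of a real symmetric matrix $M$ is $\operatorname{In}(M)=(e_+,e_-,e_0)$, where $e_+$ and $e_-$ are the numbers (with multiplicity) of positive and negative eigenvalues of $M$ and $e_0$ is the multiplicity of the eigenvalue $0$. *)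

(* Defs.v *)
From mathcomp Require Export all_boot all_order all_algebra.
From mathcomp Require Export polyrcf.
From mathcomp Require Export boolp classical_sets reals.

Set Implicit Arguments.
Unset Strict Implicit.
Unset Printing Implicit Defensive.

Import Order.TTheory GRing.Theory Num.Theory.

Local Open Scope ring_scope.

(* A graph on {1, ..., n} is a symmetric irreflexive relation e on 'I_n. *)

Definition graph_connected n (e : rel 'I_n) : Prop :=
  forall i j, connect e i j.

Section Inertia.
Variable R : realType.

Definition npos_eigen n (M : 'M[R]_n) : nat :=
  \sum_(x <- rootsR (char_poly M) | 0 < x) mup x (char_poly M).

Definition nneg_eigen n (M : 'M[R]_n) : nat :=
  \sum_(x <- rootsR (char_poly M) | x < 0) mup x (char_poly M).

Definition nzero_eigen n (M : 'M[R]_n) : nat := mup 0 (char_poly M).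

(* The entries are cast to int so that differences such as n_+ - 1 are not
   truncated. *)
Definition inertia n (M : 'M[R]_n) : int * int * int :=
  ((npos_eigen M)%:Z, (nneg_eigen M)%:Z, (nzero_eigen M)%:Z).

End Inertia.

Section MoorePenrose.
Variable R : realType.

Definition is_mpinv m n (A : 'M[R]_(m, n)) (X : 'M[R]_(n, m)) : Prop :=
  [/\ A *m X *m A = A, X *m A *m X = X,
      (A *m X)^T = A *m X & (X *m A)^T = X *m A].

Definition mpinv m n (A : 'M[R]_(m, n)) : 'M[R]_(n, m) :=
  xget 0 [set X | is_mpinv A X]%classic.

Lemma is_mpinv_uniq m n (A : 'M[R]_(m, n)) (X Y : 'M[R]_(n, m)) :
  is_mpinv A X -> is_mpinv A Y -> X = Y.
Proof.
move=> [X1 X2 X3 X4] [Y1 Y2 Y3 Y4].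
have AXY : A *m X = A *m Y.
  by rewrite -X3 -{1}Y1 -(mulmxA _ A X) trmx_mul X3 Y3 mulmxA X1.
have XYA : X *m A = Y *m A.
  by rewrite -X4 -{1}Y1 -(mulmxA A Y A) mulmxA trmx_mul X4 Y4 -mulmxA (mulmxA A) X1.
by rewrite -X2 -mulmxA AXY mulmxA XYA Y2.
Qed.

Lemma mpinv_eq m n (A : 'M[R]_(m, n)) (X : 'M[R]_(n, m)) :
  is_mpinv A X -> mpinv A = X.
Proof.
by move=> AX; apply: xget_unique => // Y AY; apply: is_mpinv_uniq AY AX.
Qed.

End MoorePenrose.

Section ResistanceDeviation.
Variables (R : realType) (n : nat) (e : rel 'I_n).

Definition adjacency : 'M[R]_n := \matrix_(i, j) (e i j)%:R.

Definition degree_mx : 'M[R]_n := diag_mx (\row_i #|[set j | e i j]|%:R).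

Definition laplacian : 'M[R]_n := degree_mx - adjacency.

Definition ones : 'cV[R]_n := const_mx 1.

Definition allones : 'M[R]_n := ones *m ones^T.

Definition proj : 'M[R]_n := 1%:M - n%:R^-1 *: allones.

Definition pinv_diag (i : 'I_n) : R := mpinv laplacian i i.

Definition pinv_diag_mx : 'M[R]_n := diag_mx (\row_i pinv_diag i).

Definition pinv_mean : R := n%:R^-1 * \tr (mpinv laplacian).

Definition deviation_mx : 'M[R]_n := pinv_diag_mx - pinv_mean%:M.

Definition deviation (i : 'I_n) : R := deviation_mx i i.

Definition deviation_op : 'M[R]_n :=
  deviation_mx *m proj + proj *m deviation_mx - deviation_mx.

Definition secular_fun (x : R) : R := \sum_i (deviation i - x)^-1.

Definition npos_dev : nat := #|[set i | 0 < deviation i]|.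
Definition nneg_dev : nat := #|[set i | deviation i < 0]|.
Definition nzero_dev : nat := #|[set i | deviation i == 0]|.

End ResistanceDeviation.

Arguments secular_fun R {n} e x.

(* The Moore-Penrose inverse of the Laplacian of a connected graph is the
   unique symmetric X with L X = X L = I - J/n and X 1 = 0. *)
Section LaplacianInverse.
Variables (R : realType) (n : nat) (e : rel 'I_n).
Hypotheses (n_gt0 : (0 < n)%N) (e_sym : symmetric e).
Hypothesis e_conn : graph_connected e.

Local Notation L := (laplacian R e).
Local Notation P := (proj R n).
Local Notation K := (n%:R^-1 *: allones R n).

Let is_pinv (X : 'M[R]_n) :=
  [/\ X^T = X, L *m X = P, X *m L = P & X *m ones R n = 0].

Let L_sym : L^T = L.
Proof.
rewrite /laplacian raddfB /= tr_diag_mx; congr (_ - _).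
by apply/matrixP => i j; rewrite !mxE e_sym.
Qed.

Let L_mul (u : 'cV[R]_n) i :
  (L *m u) i 0 = \sum_(j | e i j) (u i 0 - u j 0).
Proof.
rewrite /laplacian mulmxBl mul_diag_mx !mxE sumrB; congr (_ - _).
  by rewrite sumr_const mulr_natl cardsE.
rewrite [RHS]big_mkcond /=; apply: eq_bigr => j _; rewrite !mxE.
by case: (e i j); rewrite ?mul1r ?mul0r.
Qed.

Let L_ker (u : 'cV[R]_n) : L *m u = 0 -> forall i j, u i 0 = u j 0.
Proof.
move=> Lu0.
case: (@Order.TotalTheory.arg_maxP _ R _ (Ordinal n_gt0) predT
         (fun i => u i 0) isT) => m _ m_max.
have closed_max : closed e [pred i | u i 0 == u m 0].
  apply: intro_closed => [|i j eij]; first exact: sym_connect_sym.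
  rewrite !inE => /eqP uim.
  have /eqP := L_mul u i; rewrite Lu0 mxE eq_sym psumr_eq0 => [/allP|k _].
    move=> /(_ j (mem_index_enum j)); rewrite eij /= subr_eq0 => /eqP <-.
    exact/eqP.
  by rewrite subr_ge0 uim; exact: m_max.
have uE i : u i 0 = u m 0.
  apply/eqP; have := closed_connect closed_max (e_conn m i).
  by rewrite !inE eqxx => <-.
by move=> i j; rewrite !uE.
Qed.

Let nR_neq0 : n%:R != 0 :> R.
Proof. by rewrite pnatr_eq0 -lt0n. Qed.

Let onesT_ones : (ones R n)^T *m ones R n = n%:R%:M.
Proof.
apply/matrixP => i j; rewrite !ord1 !mxE mulr1n.
rewrite (eq_bigr (fun=> 1)) => [|k _]; last by rewrite !mxE mulr1.
by rewrite sumr_const card_ord.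
Qed.

Let K_ones : K *m ones R n = ones R n.
Proof.
rewrite -scalemxAl -mulmxA onesT_ones mul_mx_scalar scalerA mulVf //.
by rewrite scale1r.
Qed.

Let K_sym : K^T = K.
Proof. by rewrite linearZ /= trmx_mul trmxK. Qed.

Let KK : K *m K = K.
Proof. by rewrite -{1}scalemxAr mulmxA K_ones. Qed.

Let L_ones : L *m ones R n = 0.
Proof.
apply/matrixP => i j; rewrite ord1 L_mul big1 ?mxE // => k _.
by rewrite !mxE subrr.
Qed.

Let LK : L *m K = 0.
Proof. by rewrite -scalemxAr mulmxA L_ones mul0mx scaler0. Qed.

Let KL : K *m L = 0.
Proof. by rewrite -K_sym -L_sym -trmx_mul LK trmx0. Qed.

Let P_sym : P^T = P.
Proof. by rewrite /proj raddfB /= trmx1 K_sym. Qed.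

Let M := L + K.

Let MK : M *m K = K.
Proof. by rewrite mulmxDl LK add0r KK. Qed.

Let KM : K *m M = K.
Proof. by rewrite mulmxDr KL add0r KK. Qed.

Let M_sym : M^T = M.
Proof. by rewrite raddfD /= L_sym K_sym. Qed.

Let M_unit : M \in unitmx.
Proof.
rewrite -unitmx_tr -row_free_unit -kermx_eq0; apply/eqP/row_matrixP => k.
rewrite row0; set v := row k _.
have vM : M *m v^T = 0.
  by rewrite -[M]trmxK -trmx_mul /v -row_mul mulmx_ker row0 trmx0.
have Kv : K *m v^T = 0 by rewrite -KM -mulmxA vM mulmx0.
have Lv : L *m v^T = 0 by move: vM; rewrite mulmxDl Kv addr0.
have vE : v^T = K *m v^T.
  have [c vc] : exists c, v^T = c *: ones R n.
    exists (v^T (Ordinal n_gt0) 0); apply/matrixP => i j.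
    by rewrite ord1 (L_ker Lv i (Ordinal n_gt0)) !mxE mulr1.
  by rewrite vc -scalemxAr K_ones.
by apply: trmx_inj; rewrite vE Kv trmx0.
Qed.

Let X0 := invmx M - K.

Let iMK : invmx M *m K = K.
Proof. by rewrite -{1}MK mulKmx. Qed.

Let KiM : K *m invmx M = K.
Proof. by rewrite -{1}KM mulmxK. Qed.

Let X0_pinv : is_pinv X0.
Proof.
have LE : L = M - K by rewrite /M addrK.
split.
- by rewrite /X0 raddfB /= trmx_inv M_sym K_sym.
- by rewrite LE /X0 mulmxBl !mulmxBr mulmxV // MK KiM KK subrr subr0.
- by rewrite LE /X0 mulmxBl !mulmxBr mulVmx // KM iMK KK subrr subr0.
- rewrite /X0 mulmxBl -{1}K_ones mulmxA iMK.
  by rewrite subrr.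
Qed.

Let is_pinv_mp X : is_pinv X -> is_mpinv L X.
Proof.
move=> [X_sym LX XL X1].
have onesX : (ones R n)^T *m X = 0 by rewrite -X_sym -trmx_mul X1 trmx0.
split; rewrite ?LX ?XL ?P_sym // /proj mulmxBl mul1mx ?KL ?subr0 //.
by rewrite -scalemxAl -mulmxA onesX mulmx0 scaler0 subr0.
Qed.

Lemma mpinv_laplacianE (X : 'M[R]_n) :
  mpinv L = X <->
  [/\ X^T = X, L *m X = P, X *m L = P & X *m ones R n = 0].
Proof.
split=> [<-|/is_pinv_mp/mpinv_eq //].
by rewrite (mpinv_eq (is_pinv_mp X0_pinv)); exact: X0_pinv.
Qed.

End LaplacianInverse.

(* Main.v *)
Require Import Defs.
From mathcomp Require Import ring zify.
From mathcomp Require Import polyorder.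

Set Implicit Arguments.
Unset Strict Implicit.
Unset Printing Implicit Defensive.

Import Order.TTheory GRing.Theory Num.Theory.

Local Open Scope ring_scope.

(** The whole theorem reduces to the critical points of one real-rooted
    polynomial.

    Write [P] for the projection onto the complement of the all-ones vector
    and [Delta] for the diagonal matrix of deviations.  The deviations sum to
    0, so [1^T Delta 1 = 0] and the deviation operator is the compression
    [P Delta P] ([proj_compress]).  Since [P] is idempotent, [P Delta P] has
    the characteristic polynomial of [Delta P] ([char_poly_mulmxC]), which is
    a rank-one perturbation of a diagonal matrix.  The determinant formula for
    such perturbations ([det_rank1_update]) then gives, with
    [p = prod_i (X - delta_i)],
      [char_poly T = X * p' / n]    ([char_poly_deviation_op]).

    The inertia of [T] is thus read off from the zeros of [p'], with one
    zero eigenvalue added.  By Rolle's theorem [p'] splits, and its roots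
    [c] interlace the deviations ([critical_points]); so the number of
    positive roots of [p'] is [n_+] or [n_+ - 1], and likewise for the
    negative ones.  The degree of [p'] then decides:
    - if 0 is a deviation of multiplicity [n_0], it is a root of [p'] of
      multiplicity [n_0 - 1], which leaves room only for [n_+] positive and
      [n_-] negative roots;
    - if 0 is no deviation, then [p'(0) = - p(0) f(0)].  When [f(0) = 0] this
      makes 0 a root of [p'], and both counts must drop by one.  Otherwise
      exactly one of them drops, and the sign of [p'(0) / p(0)] gives the
      parity of the number of positive roots, hence which one
      ([critical_points_parity]). *)

(** * Determinants of products and rank-one updates *)

(** Adding [- U] times the lower block row to the upper one kills the upper
    right block. *)
Lemma det_schur (R : comNzRingType) m n (A : 'M[R]_m) (U : 'M[R]_(m, n))
    (V : 'M[R]_(n, m)) :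
  \det (block_mx A U V 1%:M) = \det (A - U *m V).
Proof.
have <- : block_mx 1%:M U 0 1%:M *m block_mx (A - U *m V) 0 V 1%:M
    = block_mx A U V 1%:M.
  by rewrite mulmx_block !mul1mx !mul0mx !mulmx1 !add0r subrK.
by rewrite det_mulmx det_ublock det_lblock !det1 !mulr1 mul1r.
Qed.

(** Eliminating either of the two blocks [A], [B] of [[X, A; B, 1]] gives the
    two characteristic polynomials, up to the regular factor ['X^n]. *)
Lemma char_poly_mulmxC (R : comNzRingType) n (A B : 'M[R]_n) :
  char_poly (A *m B) = char_poly (B *m A).
Proof.
apply: (monic_lreg (monicXn R n)); rewrite /char_poly /char_poly_mx !map_mxM.
set A' := map_mx _ A; set B' := map_mx _ B.
have elim_B : block_mx 1%:M 0 (- B') 'X%:M *m block_mx 'X%:M A' B' 1%:M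
    = block_mx 'X%:M A' 0 ('X%:M - B' *m A').
  rewrite mulmx_block !mul1mx !mul0mx !addr0 mulmx1 !mulNmx mul_mx_scalar.
  by rewrite mul_scalar_mx addNr addrC.
rewrite -det_schur -!(det_scalar n 'X) -(det_ublock _ A') -elim_B det_mulmx.
by rewrite det_lblock det1 mul1r.
Qed.

(** The matrix determinant lemma.  [B] stands for the adjugate of [A]: when [A]
    is diagonal, the products of all entries but one are easier to handle than
    [\adj A] itself. *)
Lemma det_rank1_update (R : idomainType) n (A B : 'M[R]_n) (d : R)
    (u : 'cV[R]_n) (v : 'rV[R]_n) :
  d != 0 -> \det A = d -> B *m A = d%:M ->
  \det (A - u *m v) = d - (v *m B *m u) 0 0.
Proof.
move=> d0 detA BA; apply: (mulfI d0).
have elim_v : block_mx 1%:M 0 (- v *m B) d%:M *m block_mx A u v 1%:M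
    = block_mx A u 0 (d%:M - v *m B *m u).
  rewrite mulmx_block !mul1mx !mul0mx !addr0 mulmx1 -mulmxA BA mul_mx_scalar.
  by rewrite mul_scalar_mx scalerN addNr addrC !mulNmx.
have := congr1 determinant elim_v.
rewrite det_mulmx det_lblock det1 mul1r det_scalar1 det_ublock detA det_schur.
by move=> ->; rewrite det_mx11 !mxE eqxx mulr1n.
Qed.

(** * Derivatives of split polynomials *)

Section SplitPoly.
Variable F : fieldType.
Implicit Types (x z : F) (s c : seq F) (p q : {poly F}).

Lemma XsubC_dvd_prod s x : x \in s -> 'X - x%:P %| \prod_(y <- s) ('X - y%:P).
Proof. by rewrite dvdp_XsubCl root_prod_XsubC. Qed.

Lemma deriv_prod_XsubC s (p := \prod_(y <- s) ('X - y%:P)) :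
  p^`() = \sum_(x <- s) p %/ ('X - x%:P).
Proof.
rewrite /p {p}; elim: s => [|y s IHs]; first by rewrite !big_nil derivC.
rewrite !big_cons derivM derivXsubC mul1r IHs mulKp ?polyXsubC_eq0 //.
congr (_ + _); rewrite mulr_sumr big_seq [RHS]big_seq; apply: eq_bigr => x xs.
by rewrite divp_mulA ?XsubC_dvd_prod.
Qed.

(** The logarithmic derivative, which is how the secular function enters. *)
Lemma horner_deriv_prod_XsubC s a (p := \prod_(y <- s) ('X - y%:P)) :
  a \notin s -> p^`().[a] = - p.[a] * \sum_(x <- s) (x - a)^-1.
Proof.
move=> as_; rewrite deriv_prod_XsubC -/p horner_sum mulr_sumr.
rewrite big_seq [RHS]big_seq; apply: eq_bigr => x xs.
have xa : x - a != 0 by rewrite subr_eq0; apply: contraNneq as_ => <-.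
have -> : p.[a] = (p %/ ('X - x%:P)).[a] * (a - x).
  by rewrite -(hornerXsubC x a) -hornerM divpK // XsubC_dvd_prod.
by rewrite -mulrN opprB mulfK.
Qed.

Lemma prod_XsubC_dvd c q : q != 0 ->
  (forall z, count_mem z c <= mup z q)%N -> \prod_(y <- c) ('X - y%:P) %| q.
Proof.
elim: c q => [|x c IHc] q q0 le_cq; first by rewrite big_nil dvd1p.
have /dvdpP [r rE] : 'X - x%:P %| q.
  by rewrite XsubC_dvd //; have := le_cq x; rewrite /= eqxx; apply: leq_ltn_trans.
have r0 : r != 0 by apply: contraNneq q0; rewrite rE => ->; rewrite mul0r.
rewrite big_cons rE mulrC dvdp_mul2r ?polyXsubC_eq0 //; apply: IHc => // z.
have := le_cq z.
rewrite rE mupM ?polyXsubC_eq0 // (mup_XsubCX 1) /= addnC.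
by case: eqP => _; rewrite ?addn0 //= !addn1 ltnS.
Qed.

Lemma mup_deriv_geq p z : p^`() != 0 -> ((mup z p).-1 <= mup z p^`())%N.
Proof.
move=> dp0; have p0 : p != 0 by apply: contraNneq dp0 => ->; rewrite derivC.
rewrite mup_geq //.
have : ('X - z%:P) ^+ mup z p %| p by rewrite -mup_geq.
case: (mup z p) => [|m] /dvdpP [r ->]; first by rewrite dvd1p.
rewrite derivM deriv_exp /= dvdp_add // dvdp_mull //.
  by rewrite exprS dvdp_mull.
by rewrite -mulr_natl dvdp_mull // dvdp_mull.
Qed.

End SplitPoly.

(** * Rolle points of a real-rooted polynomial *)

Section Rolle.
Variable R : rcfType.
Implicit Types (x z : R) (s c : seq R) (p q : {poly R}).

(** One Rolle point is picked in each gap of the sorted list, a repeated root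
    serving as its own Rolle point.  The multiplicity bounds are what makes the
    product of the [X - z], for [z] in [c], divide [p'].  The lower bound on
    [c] keeps the point of the first gap apart from all the later ones. *)
Lemma rolle_seq p x s : path <=%R x s -> all (root p) (x :: s) ->
  exists c, [/\ all2 <=%R (belast x s) c, all2 <=%R c s,
    all (>= x) c
  & forall z, if z \in x :: s then (count_mem z c < count_mem z (x :: s))%N
              else (count_mem z c <= root p^`() z)%N].
Proof.
elim: s x => [|y s IHs] x /=.
  by move=> _ _; exists [::]; split=> // z; rewrite inE eq_sym; case: eqP.
move=> /andP [le_xy ys] /andP [px /[dup] /andP [py _] pys].
have {IHs} [c [c1 c2 c3 c4]] := IHs y ys pys.
move: le_xy; rewrite le_eqVlt => /predU1P [eq_xy|lt_xy].
  rewrite -{y}eq_xy in c1 c2 c3 c4 ys py pys *.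
  exists (x :: c); rewrite /= !lexx; split=> // z; have := c4 z.
  rewrite /= !inE orbA orbb; case: ifP => [_|/negbT]; first by rewrite ltn_add2l.
  by rewrite negb_or eq_sym => /andP [/negbTE ->].
have [|g] := @poly_rolle _ _ _ p lt_xy; first by rewrite (rootP px) (rootP py).
rewrite in_itv /= => /andP [xg gy] /rootP dpg.
exists (g :: c); rewrite /= !(ltW xg) !(ltW gy); split=> //=.
  by apply: sub_all c3 => z; apply: le_trans (ltW lt_xy).
have yle z : z \in y :: s -> y <= z.
  rewrite inE => /predU1P [-> //|]; move: ys.
  by move/(order_path_min le_trans)/allP; apply.
have count0 z : z < y -> count_mem z c = 0%N.
  move=> zy; apply/count_memPn; apply: contraL zy => /(allP c3).
  by rewrite -leNgt.
move=> z; have := c4 z; rewrite [z \in [:: x, y & s]]inE.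
have [->{z} _|zx] /= := eqVneq z x.
  by rewrite gt_eqF // (count0 x lt_xy).
rewrite !add0n; case: ifP => [zys|zys].
  by rewrite (lt_eqF (lt_le_trans gy (yle z zys))).
have [<-|//] := eqVneq g z; by rewrite count0 // dpg.
Qed.

(** The Rolle points account for [size s] roots of [p'] with multiplicity, which
    is its degree: they are all the roots. *)
Lemma rolle_prod_XsubC x s (p := \prod_(y <- x :: s) ('X - y%:P)) :
  path <=%R x s ->
  exists c, [/\ p^`() = (size s).+1%:R *: \prod_(y <- c) ('X - y%:P),
    all2 <=%R (belast x s) c, all2 <=%R c s
  & {in x :: s, forall z, count_mem z c < count_mem z (x :: s)}%N].
Proof.
move=> xs.
have p_roots : all (root p) (x :: s).
  by apply/allP => z zs; rewrite /p root_prod_XsubC.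
have sz_p : size p = (size s).+2 by rewrite /p size_prod_XsubC.
have sz_dp : size p^`() = (size s).+1 by rewrite size_deriv sz_p.
have dp0 : p^`() != 0 by rewrite -size_poly_gt0 sz_dp.
have [c [c1 c2 _ c3]] := rolle_seq xs p_roots.
have sz_c : size c = size s.
  by move: c2; rewrite all2E => /andP [/eqP].
exists c; split=> // [|z zs]; last by have := c3 z; rewrite zs.
have : \prod_(y <- c) ('X - y%:P) %| p^`().
  apply: prod_XsubC_dvd => // z; have := c3 z; case: ifP => [_ lt_c|_ le_c].
    apply: leq_trans (mup_deriv_geq z dp0); rewrite /p mu_prod_XsubC.
    by rewrite -ltnS prednK // (leq_ltn_trans _ lt_c).
  apply: leq_trans le_c _; have [rz|//] := boolP (root _ z).
  by rewrite -XsubC_dvd // dvdp_XsubCl.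
move=> /dvdp_size_eqp.
rewrite size_prod_XsubC sz_c sz_dp eqxx => /esym /eqp_eq.
rewrite (monicP (monic_prod_XsubC _ _ _)) scale1r => <-; congr (_ *: _).
rewrite /lead_coef sz_dp coef_deriv; have := lead_coef_prod_XsubC (x :: s) predT id.
by rewrite /lead_coef -/p sz_p /= => ->.
Qed.

End Rolle.

(** * Signs of interlacing lists *)

Section Counting.
Variable R : realDomainType.
Implicit Types (x : R) (s c : seq R).

Lemma leq_count_sign s c : all2 <=%R s c ->
  (count (> 0)%R s <= count (> 0)%R c)%N /\
  (count (< 0)%R c <= count (< 0)%R s)%N.
Proof.
elim: s c => [|a s IHs] [|b c] //= /andP [le_ab /IHs [pos neg]].
split; apply: leq_add => //.
  by case: ltP => // /lt_le_trans -> //.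
by case: (ltP b 0) => // /(le_lt_trans le_ab) ->.
Qed.

Lemma count_interlace x s c : all2 <=%R (belast x s) c -> all2 <=%R c s ->
  (count (> 0)%R c <= count (> 0)%R (x :: s) <= (count (> 0)%R c).+1)%N /\
  (count (< 0)%R c <= count (< 0)%R (x :: s) <= (count (< 0)%R c).+1)%N.
Proof.
move=> /leq_count_sign [pos_c neg_c] /leq_count_sign [pos_s neg_s].
have Ebel P : count P (x :: s) = (count P (belast x s) + P (last x s))%N.
  by rewrite lastI -cats1 count_cat /= addn0.
split; apply/andP; split.
- exact: leq_trans pos_s (leq_addl _ _).
- by rewrite Ebel -addn1 leq_add ?leq_b1.
- by rewrite Ebel; apply: leq_trans neg_c (leq_addr _ _).
- by rewrite /= -add1n leq_add ?leq_b1.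
Qed.

Lemma count_signs s :
  (count (> 0)%R s + count (< 0)%R s + count_mem 0%R s = size s)%N.
Proof.
by elim: s => //= a s <-; case: (ltgtP a 0) => _; rewrite /= ?add0n; lia.
Qed.

Lemma sgr_prod_opp s : 0 \notin s ->
  Num.sg (\prod_(x <- s) - x) = (-1) ^+ count (> 0)%R s.
Proof.
elim: s => [|a s IHs]; first by rewrite big_nil sgr1.
rewrite inE negb_or eq_sym => /andP [a0 /IHs sg_s].
rewrite big_cons sgrM sg_s sgrN /= exprD.
case: (ltgtP 0 a) a0 => // [a_gt0|a_lt0] _; first by rewrite gtr0_sg // expr1.
by rewrite ltr0_sg // opprK.
Qed.

End Counting.

(** The interlacing of a polynomial's roots with its critical points, in the
    form of counts, which do not depend on the order of the roots. *)
Lemma critical_points (R : rcfType) (s : seq R) : s != [::] ->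
  exists c, [/\ (\prod_(x <- s) ('X - x%:P))^`() =
      (size s)%:R *: \prod_(x <- c) ('X - x%:P),
    (size c).+1 = size s,
    (count (> 0)%R c <= count (> 0)%R s <= (count (> 0)%R c).+1)%N,
    (count (< 0)%R c <= count (< 0)%R s <= (count (< 0)%R c).+1)%N
  & {in s, forall z, count_mem z c < count_mem z s}%N].
Proof.
have sort_s : perm_eq (sort <=%R s) s by rewrite perm_sort.
have := sort_le_sorted s; rewrite -size_eq0.
rewrite -!(perm_size sort_s) -!(perm_big _ sort_s) -!(permP sort_s) /=.
case sortE: (sort _ s) sort_s => [|x t] // sort_s xt _.
have [c [dp c1 c2 c3]] := rolle_prod_XsubC xt.
have [pos_c neg_c] := count_interlace c1 c2.
exists c; split=> //= [|z].
  by move: c2; rewrite all2E => /andP [/eqP ->].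
by rewrite -(perm_mem sort_s) -(permP sort_s) /=; apply: c3.
Qed.

Lemma odd_leq_succ m k : (m <= k <= m.+1)%N -> k = (m + (odd m (+) odd k))%N.
Proof.
rewrite leq_eqVlt => /andP [/predU1P [->|mk] km]; first by rewrite addbb addn0.
have -> : k = m.+1 by apply/eqP; rewrite eqn_leq km.
by rewrite /= addbN addbb addn1.
Qed.

(** At 0, the derivative of [p = prod (X - x)] is [- p(0)] times the sum of the
    [x^-1], and the sign of a split polynomial at 0 is the parity of its number
    of positive roots. *)
Lemma critical_points_parity (R : realFieldType) (s c : seq R) (k : R)
    (f0 := \sum_(x <- s) x^-1) :
  0 < k -> 0 \notin s ->
  (\prod_(x <- s) ('X - x%:P))^`() = k *: \prod_(x <- c) ('X - x%:P) ->
  (0 \in c) = (f0 == 0) /\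
  (f0 != 0 -> odd (count (> 0)%R c) (+) odd (count (> 0)%R s) = (0 < f0)).
Proof.
move=> k_gt0 s0 dp.
have prod0 t : (\prod_(x <- t) ('X - x%:P)).[0] = \prod_(x <- t) - x :> R.
  by rewrite horner_prod; apply: eq_bigr => x _; rewrite hornerXsubC sub0r.
have prod_eq0 t : (\prod_(x <- t) - x == 0 :> R) = (0 \in t).
  by rewrite -prod0 -rootE root_prod_XsubC.
have dp0 : k * \prod_(x <- c) - x = - (\prod_(x <- s) - x) * f0.
  rewrite -!prod0 -hornerZ -dp horner_deriv_prod_XsubC //; congr (_ * _).
  by apply: eq_bigr => x _; rewrite subr0.
have c0E : (0 \in c) = (f0 == 0).
  have := congr1 (fun a => a == 0) dp0.
  by rewrite /= !mulf_eq0 oppr_eq0 !prod_eq0 (negbTE s0) (gt_eqF k_gt0).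
split=> // f0N0; have := congr1 Num.sg dp0.
rewrite !sgrM sgrN !sgr_prod_opp ?c0E // gtr0_sg // mul1r -neqr0_sign //.
rewrite -[LHS]signr_odd -[in RHS]signr_odd -signrN -signr_addb => /signr_inj ->.
by rewrite [0 < f0]lt0r f0N0 [0 <= f0]leNgt; case: (odd _); case: (f0 < 0).
Qed.

(** * Inertia from a split characteristic polynomial *)

Lemma inertia_char_poly (R : realType) n (M : 'M[R]_n) (s : seq R) :
  char_poly M = \prod_(x <- s) ('X - x%:P) ->
  inertia M = ((count (> 0)%R s)%:Z, (count (< 0)%R s)%:Z, (count_mem 0%R s)%:Z).
Proof.
move=> chM; rewrite /inertia /npos_eigen /nneg_eigen /nzero_eigen chM.
set p := \prod_(x <- s) _.
have p0 : p != 0 by rewrite monic_neq0 // monic_prod_XsubC.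
have roots_p : perm_eq (rootsR p) (undup s).
  apply: uniq_perm; rewrite ?undup_uniq ?uniq_roots // => x.
  by rewrite mem_undup -(roots_on_rootsR p0) root_prod_XsubC.
have count_roots P : (\sum_(x <- rootsR p | P x) mup x p = count P s)%N.
  rewrite (perm_big _ roots_p) -sum1_count -[RHS]big_undup_iterop_count /=.
  by apply: eq_bigr => x _; rewrite mu_prod_XsubC Monoid.iteropE iter_addn_0 mul1n.
by rewrite !count_roots mu_prod_XsubC.
Qed.

(** * The compressed diagonal matrix *)

Section Compression.
Variables (R : realType) (n : nat).
Hypothesis n_gt0 : (0 < n)%N.
Local Notation P := (proj R n).

Lemma ones_mul_tr : (ones R n)^T *m ones R n = n%:R%:M.
Proof.
apply/matrixP => i j; rewrite !ord1 !mxE mulr1n.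
rewrite (eq_bigr (fun=> 1)) => [|k _]; last by rewrite !mxE mulr1.
by rewrite sumr_const card_ord.
Qed.

Lemma allones_sq : allones R n *m allones R n = n%:R *: allones R n.
Proof.
rewrite /allones mulmxA -[_ *m _ *m ones R n]mulmxA ones_mul_tr.
by rewrite mul_mx_scalar scalemxAl.
Qed.

Lemma proj_idem : P *m P = P.
Proof.
have n0 : n%:R != 0 :> R by rewrite pnatr_eq0 -lt0n.
rewrite {2}/proj mulmxBr mulmx1 -scalemxAr /proj mulmxBl mul1mx -scalemxAl.
by rewrite allones_sq scalerA mulVf // scale1r subrr scaler0 subr0.
Qed.

(** The hypothesis is exactly that [J D J = 0], the only term in which the two
    sides differ. *)
Lemma proj_compress (D : 'M[R]_n) : (ones R n)^T *m D *m ones R n = 0 ->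
  P *m D *m P = D *m P + P *m D - D.
Proof.
move=> D0.
have JDJ : allones R n *m D *m allones R n = 0.
  by rewrite /allones !mulmxA -!(mulmxA (ones R n)) mulmxA D0 mulmx0 mul0mx.
have PDJ : P *m D *m allones R n = D *m allones R n.
  by rewrite /proj !mulmxBl mul1mx -!scalemxAl JDJ scaler0 subr0.
rewrite {2}/proj mulmxBr mulmx1 -scalemxAr PDJ.
by rewrite [D *m P]mulmxBr mulmx1 -scalemxAr [RHS]addrAC (addrAC D) subrr add0r addrC.
Qed.

(** With [b i] the product of the [X - d j] for [j != i], the determinant of
    [X - D P] is [p] plus the sum of the [d i * b i / n]; spreading [p] over
    the [n] terms as [p = (X - d i) * b i] turns this into the sum of the
    [X * b i / n], that is [X * p' / n]. *)
Lemma char_poly_compress (d : 'I_n -> R) (D := diag_mx (\row_i d i))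
    (p := \prod_(x <- [seq d i | i : 'I_n]) ('X - x%:P)) :
  char_poly (P *m D *m P) = n%:R^-1 *: ('X * p^`()).
Proof.
have n0 : n%:R != 0 :> R by rewrite pnatr_eq0 -lt0n.
rewrite -mulmxA char_poly_mulmxC -mulmxA proj_idem /char_poly /char_poly_mx.
(* The cofactors of the diagonal matrix of the [X - d i]. *)
pose b i := p %/ ('X - (d i)%:P).
have dp i : 'X - (d i)%:P %| p by apply: XsubC_dvd_prod; apply: codom_f.
have pE : p = \prod_i ('X - (d i)%:P) by rewrite /p big_image.
have p0 : p != 0 by rewrite monic_neq0 // monic_prod_XsubC.
pose u : 'cV[{poly R}]_n := \col_i - (n%:R^-1 * d i)%:P.
have -> : 'X%:M - map_mx polyC (D *m P)
    = diag_mx (\row_i ('X - (d i)%:P)) - u *m const_mx 1.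
  apply/matrixP => i j; rewrite mul_diag_mx !mxE !big_ord1 !mxE.
  rewrite !mulr1 mulrBr polyCB [d i * n%:R^-1]mulrC opprB addrA opprK.
  by case: eqP => _ /=; rewrite (mulr1, mulr0) ?subr0 // addrAC.
rewrite (@det_rank1_update _ _ _ (diag_mx (\row_i b i)) p) //; last 2 first.
- by rewrite det_diag pE; apply: eq_bigr => i _; rewrite !mxE.
- rewrite mulmx_diag -diag_const_mx; congr diag_mx; apply/rowP => i.
  by rewrite !mxE divpK.
rewrite mul_mx_diag !mxE deriv_prod_XsubC -/p big_image /= mulr_sumr scaler_sumr.
have {1}-> : p = \sum_(i < n) n%:R^-1 *: p.
  by rewrite sumr_const card_ord -scaler_nat scalerA divff // scale1r.
rewrite -sumrB; apply: eq_bigr => i _; rewrite !mxE mul1r.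
rewrite -[in LHS](divpK (dp i)) -/(b i) -!mul_polyC polyCM.
ring.
Qed.

End Compression.

(** * The deviation operator *)

Section Deviations.
Variables (R : realType) (n : nat) (e : rel 'I_n).
Hypothesis n_gt0 : (0 < n)%N.
Local Notation delta := (deviation R e).

Lemma deviation_mxE : deviation_mx R e = diag_mx (\row_i delta i).
Proof.
apply/matrixP => i j; rewrite !mxE /deviation !mxE eqxx.
by case: eqP => [->|_]; rewrite ?subr0.
Qed.

Lemma tr_deviation_mx : \tr (deviation_mx R e) = 0.
Proof.
rewrite /deviation_mx raddfB /= mxtrace_scalar mxtrace_diag.
rewrite -mulr_natl /pinv_mean mulVKf ?pnatr_eq0 -?lt0n //; apply/eqP; rewrite subr_eq0.
by apply/eqP/eq_bigr => i _; rewrite mxE.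
Qed.

Lemma char_poly_deviation_op
    (p := \prod_(x <- [seq delta i | i : 'I_n]) ('X - x%:P)) :
  char_poly (deviation_op R e) = n%:R^-1 *: ('X * p^`()).
Proof.
rewrite -char_poly_compress // -deviation_mxE proj_compress //.
apply/matrixP => i j; rewrite !ord1 -mulmxA !mxE -[RHS]tr_deviation_mx.
apply: eq_bigr => k _; rewrite deviation_mxE mul_diag_mx !mxE eqxx mulr1 mul1r.
by [].
Qed.

Lemma card_deviation (P : pred R) :
  #|[set i | P (delta i)]| = count P [seq delta i | i : 'I_n].
Proof.
by rewrite cardsE cardE size_filter count_map enumT.
Qed.

End Deviations.

Theorem theorem2p8 (R : realType) (n : nat) (n_gt0 : (0 < n)%N)
    (e : rel 'I_n) (e_sym : symmetric e) (e_irr : irreflexive e)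
    (e_conn : graph_connected e) :
  let T := deviation_op R e in
  let f0 := secular_fun R e 0 in
  let np := (npos_dev R e)%:Z in
  let nm := (nneg_dev R e)%:Z in
  ((forall i, deviation R e i != 0) ->
    [/\ f0 < 0 -> inertia T = (np, nm - 1, 1),
        0 < f0 -> inertia T = (np - 1, nm, 1)
      & f0 = 0 -> inertia T = (np - 1, nm - 1, 2)]) /\
  (forall n0 : nat, (0 < n0)%N -> nzero_dev R e = n0 ->
    inertia T = (np, nm, n0%:Z)).
Proof.
move=> T f0 np nm; set delta := deviation R e.
pose s := [seq delta i | i : 'I_n].
have sz_s : size s = n by rewrite size_image card_ord.
have [|c [dp sz_c pos_c neg_c zero_c]] := @critical_points R s.
  by rewrite -size_eq0 sz_s -lt0n.
have nR0 : n%:R != 0 :> R by rewrite pnatr_eq0 -lt0n.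
have chT : char_poly T = \prod_(x <- 0 :: c) ('X - x%:P).
  rewrite /T char_poly_deviation_op // dp sz_s big_cons subr0.
  by rewrite -scalerAr scalerA mulVf // scale1r.
rewrite (inertia_char_poly chT) /= ltxx eqxx !add0n.
have npE : npos_dev R e = count (> 0) s by apply: card_deviation.
have nmE : nneg_dev R e = count (< 0) s by apply: card_deviation.
have nzE : nzero_dev R e = count_mem 0 s.
  exact: (@card_deviation R n e (pred1 0)).
rewrite /np /nm npE nmE nzE.
have := count_signs s; rewrite -sz_c -(count_signs c) => cnt.
split=> [delta0|n0 n0_gt0 n0E]; last first.
  (* From [s] to [c] the multiplicity of 0 drops by at least one and the size
     by exactly one, so no other count can drop. *)
  have /zero_c : 0 \in s by rewrite -has_pred1 has_count n0E.
  move: pos_c neg_c n0E cnt.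
  move: (count _ _) (count _ _) (count _ _) (count _ _) (count _ _) (count _ _).
  move=> a b c' d f g *; congr (_, _, _); lia.
have s0 : 0 \notin s.
  by apply/mapP => -[i _ /esym/eqP]; rewrite (negbTE (delta0 i)).
have f0E : f0 = \sum_(x <- s) x^-1.
  by rewrite big_image; apply: eq_bigr => i _; rewrite subr0.
have n_gt0R : 0 < (size s)%:R :> R by rewrite sz_s ltr0n.
have [c0E odd_c] := critical_points_parity n_gt0R s0 dp.
rewrite -f0E in c0E odd_c.
have count0_s : count_mem 0 s = 0%N by apply/count_memPn.
rewrite count0_s addn0 in cnt.
have [f0_eq0|f0N0] := eqVneq f0 0.
  have c_gt0 : (0 < count_mem 0%R c)%N.
    by rewrite -has_count has_pred1 c0E f0_eq0.
  rewrite f0_eq0 ltxx; split=> // _; move: pos_c neg_c cnt c_gt0.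
  move: (count _ _) (count _ _) (count _ _) (count _ _) (count _ _).
  by move=> *; congr (_, _, _); lia.
have count0_c : count_mem 0 c = 0%N by apply/count_memPn; rewrite c0E.
have posE := odd_leq_succ pos_c; rewrite odd_c // in posE.
rewrite posE count0_c in cnt *.
split=> [f0_lt0|f0_gt0|/eqP]; last by rewrite (negbTE f0N0).
  rewrite (lt_gtF f0_lt0) in cnt *; move: neg_c cnt; rewrite !addn0.
  by move: (count _ _) (count _ _) (count _ _) => *; congr (_, _, _); lia.
rewrite f0_gt0 in cnt *; move: neg_c cnt.
by move: (count _ _) (count _ _) (count _ _) => *; congr (_, _, _); lia.
Qed.
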